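(* Consider the energy redistribution model with redistribution measure $\nu(s,d\epsilon)$. Let $S$ be any non-negative random variable and let $\epsilon$ be a $[0,1]$-valued random variable which, conditionally on $S=s$, is distributed according to $\nu(s,d\epsilon)$. Then the distribution of $$(\epsilon S,\ (1-\epsilon)S)$$ is an invariant probability measure for the model. Moreover, every invariant probability measure of the model is of this form for some non-negative random variable $S$.
   Context: State space $E=[0,\infty)^2$. For $\epsilon\in[0,1]$ let $T_\epsilon:E\to E$, $T_\epsilon(x,y)=(\epsilon(x+y),(1-\epsilon)(x+y))$. A redistribution measure $\nu=\nu(s,d\epsilon)=\nu(s,\epsilon)\,d\epsilon$ is a weakly continuous map $s\mapsto\nu(s,\cdot)$ from $[0,\infty)$ into the space of absolutely continuous probability measures on $[0,1]$ with full support. The energy redistribution model based on $\nu$ is the continuous-time Markov jump process on $E$ in which, from state $(x,y)$, after an exponential waiting time of mean one, the state is replaced by $T_\epsilon(x,y)$ with $\epsilon$ distributed according to $\nu(x+y,d\epsilon)$. Its generator on bounded continuous $f:E\to\mathbb R$ is $\mathcal L f=Pf-f$, where $Pf(x,y)=\int_0^1 f(T_\epsilon(x,y))\,\nu(x+y,\epsilon)\,d\epsilon$. A probability measure $m$ on $E$ is invariant if $\int Pf\,dm=\int f\,dm$ for all bounded continuous $f$. *)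

(* Defs.v *)
From HB Require Import structures.
From mathcomp Require Import all_boot all_order all_algebra.
From mathcomp Require Import all_classical all_reals all_analysis measurable_realfun.

Set Implicit Arguments.
Unset Strict Implicit.
Unset Printing Implicit Defensive.

Import Order.TTheory GRing.Theory Num.Theory.
Import numFieldNormedType.Exports.

Local Open Scope classical_set_scope.
Local Open Scope ring_scope.

Definition state_space (R : realType) : set (R * R) :=
  [set z | 0 <= z.1 /\ 0 <= z.2].

Definition redistribute (R : realType) (e : R) (z : R * R) : R * R :=
  (e * (z.1 + z.2), (1 - e) * (z.1 + z.2)).

(* The total energy [s] ranges over [0, +oo[: all axioms are restricted to
   [0 <= s], and the values at negative [s] are never used.  A probability
   measure on [0, 1] is represented as a probability measure on [R]; by
   [rm_densityE] it gives mass 0 to the complement of [0, 1].  A version of the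
   density is part of the data. *)
Record redistribution_measure (R : realType) := RedistributionMeasure {
  rm_law : R -> probability R R ;
  rm_density : R -> R -> R ;
  rm_density_ge0 : forall s e, 0 <= s -> 0 <= e <= 1 -> 0 <= rm_density s e ;
  rm_density_measurable : forall s, 0 <= s ->
    measurable_fun (`[0, 1] : set R) (rm_density s) ;
  rm_densityE : forall s (B : set R), 0 <= s -> measurable B ->
    rm_law s B =
      (\int[lebesgue_measure]_(e in B `&` `[0%R, 1%R]) (rm_density s e)%:E)%E ;
  (* the topological support of [rm_law s] in [0, 1] is all of [0, 1] *)
  rm_full_support : forall s (U : set R), 0 <= s -> open U ->
    U `&` `[0, 1] !=set0 -> (0 < rm_law s (U `&` `[0%R, 1%R]))%E ;
  rm_weakly_continuous : forall g : R -> R,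
    {within `[0, 1], continuous g} ->
    {within `[0, +oo[, continuous
      (fun s => \int[rm_law s]_(e in `[0, 1]) g e)}
}.

Section energy_redistribution.
Context (R : realType) (nu : redistribution_measure R).

Definition transition_operator (f : R * R -> R) (z : R * R) : R :=
  \int[lebesgue_measure]_(e in `[0, 1])
    (f (redistribute e z) * rm_density nu (z.1 + z.2) e).

Definition is_invariant (m : probability (R * R)%type R) : Prop :=
  m (@state_space R) = 1%E /\
  forall f : R * R -> R,
    {within @state_space R, continuous f} ->
    [bounded f z | z in @state_space R] ->
    \int[m]_(z in @state_space R) transition_operator f z =
    \int[m]_(z in @state_space R) f z.

Context d (Omega : measurableType d) (P : probability Omega R).

(* Conditionally on [S = s], [eps] has law [nu(s, .)]: disintegration of the
   joint law of [(S, eps)] with respect to the law of the nonnegative [S]. *)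
Definition conditional_law (S eps : {RV P >-> R}) : Prop :=
  forall A B : set R, measurable A -> measurable B ->
    A `<=` `[0, +oo[ ->
    P (S @^-1` A `&` eps @^-1` B) =
      (\int[distribution P S]_(s in A) rm_law nu s B)%E.

End energy_redistribution.

Section energy_split.
Context (R : realType) d (Omega : measurableType d).

Definition energy_split (S eps : Omega -> R) (w : Omega) :
    R * R :=
  (eps w * S w, (1 - eps w) * S w).

Context (S eps : {mfun Omega >-> R}).

Lemma energy_split_measurable : measurable_fun [set: Omega] (energy_split S eps).
Proof.
rewrite /energy_split; apply: measurable_fun_pair.
- exact: measurable_funM.
- by apply: measurable_funM => //; apply: measurable_funB.
Qed.

HB.instance Definition _ :=
  isMeasurableFun.Build _ _ _ _ (energy_split S eps) energy_split_measurable.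

End energy_split.

(* Main.v *)
(** Since [T_e(x, y)] depends on [(x, y)] only through [x + y], [Pf(x, y)] is
    the mean [G(x + y)] of [f(e s, (1 - e) s)] over [e ~ nu(s, .)] at
    [s = x + y], and the two coordinates of [(eps S, (1 - eps) S)] add up to
    [S]: both sides of the invariance equation are equal to [E (G(S))].
    Conversely, if [m] is invariant and [S] has the law of [x + y] under [m],
    then [\int f dm = \int Pf dm = E (G(S)) = E (f(eps S, (1 - eps) S))] for
    every bounded continuous [f], and these integrals determine [m].
    The technical point is that [nu] is a probability kernel: measurability of
    [s |-> nu(s, B)] is deduced from weak continuity, by approximating the
    indicators of open rays by continuous ramps. *)

From HB Require Import structures.
Require Import Defs.
From mathcomp Require Import all_boot all_order all_algebra.
From mathcomp Require Import all_classical all_reals all_analysis.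
From mathcomp Require Import measurable_realfun giry lra.
Import Order.TTheory GRing.Theory Num.Theory.
Import numFieldNormedType.Exports.
Set Implicit Arguments.
Unset Strict Implicit.
Local Open Scope classical_set_scope.
Local Open Scope ring_scope.

(** * Bounded functions under a probability measure *)

Lemma bounded_integrable_probability {d} {T : measurableType d} {R : realType}
    (m : probability T R) (f : T -> R) (M : R) (D : set T) :
  measurable D -> measurable_fun setT f -> (forall x, `|f x| <= M) ->
  m.-integrable D (EFin \o f).
Proof.
move=> mD mf fM; apply: measurable_bounded_integrable => //.
- by rewrite (le_lt_trans (probability_le1 _ _)) ?ltry.
- exact: measurable_funTS.
- by exists M; split => [|N MN x _ /=]; rewrite ?num_real// (le_trans (fM x))// ltW.
Qed.

Lemma EFin_Rintegral {d} {T : measurableType d} {R : realType}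
    (m : {measure set T -> \bar R}) (D : set T) (f : T -> R) :
  measurable D -> m.-integrable D (EFin \o f) ->
  (\int[m]_(x in D) f x)%:E = (\int[m]_(x in D) (f x)%:E)%E.
Proof. by move=> mD fi; rewrite fineK//; exact: integrable_fin_num. Qed.

Lemma Rintegral_cst_probability {d} {T : measurableType d} {R : realType}
    (m : probability T R) (c : R) : \int[m]_(_ in setT) c = c.
Proof. by rewrite Rintegral_cst// [X in fine X]probability_setT mulr1. Qed.

(** * The product sigma-algebra of the plane *)

Section plane.
Context {R : realType}.
Local Notation ray x := (`]x, +oo[%classic : set R).
Implicit Types (a b : R) (A B : set R).

Definition open_quadrants : set (set (R * R)) :=
  [set C | exists a b, C = ray a `*` ray b].

Lemma bigcup_ray : \bigcup_n ray (- n%:R) = setT.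
Proof.
apply/seteqP; split => // x _; exists (Num.truncn `|x|).+1 => //=.
rewrite in_itv/= andbT ltrNl (le_lt_trans _ (truncnS_gt _))//.
by rewrite -normrN ler_norm.
Qed.

(** The preimage of a ray under either projection is a countable union of quadrants. Hence both
    projections are measurable for the sigma-algebra that quadrants generate, which therefore
    contains all measurable rectangles. *)
Lemma measurable_prod_open_quadrants :
  (@measurable _ (R * R)%type) = <<s open_quadrants >>.
Proof.
pose T := g_sigma_algebraType open_quadrants.
have mf : measurable_fun [set: T] (fst : T -> R).
  apply: (measurability _ (RGenOInfty.measurableE R)) => _ [_ [a ->] <-].
  rewrite setTI.
  rewrite (_ : _ @^-1` _ = \bigcup_n (ray a `*` ray (- n%:R))).
    by apply: bigcup_measurable => n _; apply: sub_sigma_algebra; do 2 eexists.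
  by rewrite -setX_bigcupr bigcup_ray; apply/seteqP; split => -[x y] //= [].
have ms : measurable_fun [set: T] (snd : T -> R).
  apply: (measurability _ (RGenOInfty.measurableE R)) => _ [_ [b ->] <-].
  rewrite setTI.
  rewrite (_ : _ @^-1` _ = \bigcup_n (ray (- n%:R) `*` ray b)).
    by apply: bigcup_measurable => n _; apply: sub_sigma_algebra; do 2 eexists.
  by rewrite -setX_bigcupl bigcup_ray; apply/seteqP; split => -[x y] //= [].
rewrite measurable_prod_measurableType; apply/seteqP; split.
  apply: smallest_sub; first exact: smallest_sigma_algebra.
  move=> _ [A mA [B mB <-]].
  have := @measurableI _ T _ _ (mf measurableT _ mA) (ms measurableT _ mB).
  by rewrite !setTI.
apply: smallest_sub; first exact: smallest_sigma_algebra.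
move=> _ [a [b ->]]; apply: sub_sigma_algebra.
by exists (ray a) => //; exists (ray b).
Qed.

(** Quadrants are stable under intersection, and countably many of them, all of finite mass, cover
    the plane; so uniqueness of measures applies. *)
Lemma measure_eq_quadrants (m1 m2 : probability (R * R)%type R) :
  (forall a b, m1 (ray a `*` ray b) = m2 (ray a `*` ray b)) ->
  forall C, measurable C -> m1 C = m2 C.
Proof.
move=> m12; apply: (measure_unique open_quadrants
  (fun n => ray (- n%:R) `*` ray (- n%:R))).
- exact: measurable_prod_open_quadrants.
- move=> _ _ [a [b ->]] [c [d ->]]; exists (Num.max a c), (Num.max b d).
  rewrite -setXI; congr (_ `*` _); apply/seteqP; split => x /=;
    rewrite !in_itv/= !andbT gt_max; [by move=> [-> ->]|by move=> /andP[]
    |by move=> [-> ->]|by move=> /andP[]].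
- by move=> n; do 2 eexists.
- apply/seteqP; split => // -[x y] _.
  (* The point [- |x| - |y|] lies below both [x] and [y], so a single [n] serves both
     coordinates. *)
  have : (\bigcup_n ray (- n%:R)) (- `|x| - `|y|) by rewrite bigcup_ray.
  move=> [n _ /=]; rewrite in_itv/= andbT => h; exists n => //=.
  have := ler_norm (- x); have := ler_norm (- y); rewrite !normrN.
  have := normr_ge0 x; have := normr_ge0 y.
  by rewrite !in_itv/= !andbT => ? ? ? ?; split; lra.
- by move=> _ [a [b ->]]; exact: m12.
- by move=> n; rewrite (le_lt_trans (probability_le1 _ _)) ?ltry//; apply: measurableX.
Qed.

(* The sigma-algebra on [R * R] is the product one, not the Borel one. *)
Lemma open_prod_measurable (O : set (R * R)) : open O -> measurable O.
Proof.
move=> oO.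
(* There are countably many boxes with rational end points, and the open set is the union of those
   that it contains. *)
pose F (q : (rat * rat) * (rat * rat)) : set (R * R) :=
  `]ratr q.1.1, ratr q.1.2[ `*` `]ratr q.2.1, ratr q.2.2[.
rewrite (_ : O = \bigcup_(q in [set q | F q `<=` O]) F q).
  rewrite bigcup_mkcond; apply: countable_bigcupT_measurable => // q.
  by case: ifP => // _; exact: measurableX.
apply/seteqP; split; last by move=> z [q /= qO] /qO.
move=> [x y] Oxy.
have /nbhs_ballP[e /= e0 eO] : nbhs (x, y) O by apply: open_nbhs_nbhs.
have near (t : R) : exists p q : rat, (t - e < ratr p < t) /\ (t < ratr q < t + e).
  have /rat_in_itvoo[p pt] : t - e < t by rewrite ltrBlDr ltrDl.
  have /rat_in_itvoo[q qt] : t < t + e by rewrite ltrDl.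
  by exists p, q; move: pt qt; rewrite !in_itv.
have [p [q [/andP[px1 px2] /andP[qx1 qx2]]]] := near x.
have [r [s [/andP[py1 py2] /andP[qy1 qy2]]]] := near y.
exists ((p, q), (r, s)) => /=; last by rewrite /F /= !in_itv/= px2 qx1 py2 qy1.
move=> [u v] [/=]; rewrite !in_itv/= => /andP[u1 u2] /andP[v1 v2].
by apply: eO; split; rewrite /ball/= ltr_norml; apply/andP; split; lra.
Qed.

Lemma continuous_prod_measurable_fun (f : R * R -> R) :
  continuous f -> measurable_fun setT f.
Proof.
move=> /continuousP cf; apply: (measurability _ (RGenOInfty.measurableE R)).
move=> _ [_ [a ->] <-]; rewrite setTI; apply: open_prod_measurable.
exact/cf/interval_open.
Qed.

End plane.

(** * Continuous test functions determine a probability measure on the plane *)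

Section ramp.
Context {R : realType}.
Implicit Types (a x : R) (n : nat).

(** Continuous minorants of the indicator of []a, +oo[]: they serve as test functions wherever a
    hypothesis speaks of continuous functions only. *)
Definition ramp a n x : R := Num.min 1 (n%:R * Num.max 0 (x - a)).

Lemma ramp_ge0 a n x : 0 <= ramp a n x.
Proof. by rewrite le_min ler01 mulr_ge0// le_max lexx. Qed.

Lemma ramp_le1 a n x : ramp a n x <= 1.
Proof. by rewrite ge_min lexx. Qed.

Lemma continuous_ramp a n : continuous (ramp a n).
Proof.
move=> x.
apply: (@continuous_min _ R (cst 1) (fun y => n%:R * Num.max 0 (y - a))).
  exact: cvg_cst.
apply: (@continuousM _ R (cst n%:R) (fun y => Num.max 0 (y - a))).
  exact: cvg_cst.
apply: (@continuous_max _ R (cst 0) (fun y => y - a)); first exact: cvg_cst.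
by apply: (@continuousB _ R^o R id (cst a)); [exact: cvg_id|exact: cvg_cst].
Qed.

Lemma cvg_ramp a x : ramp a n x @[n --> \oo] --> (\1_`]a, +oo[ x : R).
Proof.
apply: cvg_near_cst; rewrite indicE; have [ax|xa] := ltP a x.
  (* For [a < x] the ramp is saturated at 1 as soon as [n] exceeds the inverse of [x - a]; for
     [x <= a] it is 0 for every [n]. *)
  exists (Num.truncn (x - a)^-1).+1 => // n /= hn.
  rewrite mem_set ?mulr1n/= ?in_itv/= ?ax// /ramp max_r ?subr_ge0 ?(ltW ax)//.
  apply: min_l; rewrite -ler_pdivrMr ?subr_gt0// mul1r.
  by rewrite (le_trans (ltW (truncnS_gt _)))// ler_nat.
apply: nearW => n; rewrite memNset /= ?in_itv/= ?andbT; last first.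
  by apply/negP; rewrite -leNgt.
by rewrite /ramp max_l ?subr_le0// mulr0 min_r.
Qed.

Lemma measurable_ramp a n : measurable_fun setT (ramp a n).
Proof. by apply: continuous_measurable_fun; exact: continuous_ramp. Qed.

End ramp.

(** Products of two ramps tend pointwise to the indicator of the quadrant and are dominated by the
    constant 1. *)
Lemma quadrant_integral_cvg {R : realType} (m : probability (R * R)%type R)
    (a b : R) :
  (\int[m]_z (ramp a n z.1 * ramp b n z.2)%:E)%E @[n --> \oo] -->
  m (`]a, +oo[ `*` `]b, +oo[).
Proof.
pose C := (`]a, +oo[ `*` `]b, +oo[)%classic : set (R * R).
have mC : measurable C by exact: measurableX.
have -> : m C = (\int[m]_z (\1_C z)%:E)%E by rewrite integral_indic// setIT.
apply: (@dominated_cvg _ _ _ m setT measurableT _ _ (cst 1%E)) => //.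
- move=> n; apply/measurable_EFinP; apply: measurable_funM;
    by apply: measurableT_comp => //; exact: measurable_ramp.
- move=> [x y] _; apply/cvg_EFin; first exact: nearW.
  have -> : \1_C (x, y) = \1_`]a, +oo[ x * \1_`]b, +oo[ y :> R.
    by rewrite !indicE in_setX -mulnb natrM.
  by apply: cvgM; exact: cvg_ramp.
- exact: finite_measure_integrable_cst.
- move=> n z _ /=; rewrite lee_fin ger0_norm; last by rewrite mulr_ge0 ?ramp_ge0.
  by rewrite mulr_ile1 ?ramp_ge0 ?ramp_le1.
Qed.

(** Products of ramps are admissible test functions, so the mass of a quadrant under either measure
    is the limit of one and the same sequence. Quadrants then determine the measure. *)
Lemma measure_eq_continuous {R : realType} (m1 m2 : probability (R * R)%type R) :
  (forall f : R * R -> R, continuous f -> (forall z, 0 <= f z <= 1) ->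
    \int[m1]_z f z = \int[m2]_z f z) ->
  forall C, measurable C -> m1 C = m2 C.
Proof.
move=> m12; apply: measure_eq_quadrants => a b.
apply/esym; apply: (cvg_unique _ (quadrant_integral_cvg (m := m2) (a := a) (b := b))) => //.
have -> : (fun n => \int[m2]_z (ramp a n z.1 * ramp b n z.2)%:E)%E =
          (fun n => \int[m1]_z (ramp a n z.1 * ramp b n z.2)%:E)%E.
  apply/funext => n.
  pose f (z : R * R) := ramp a n z.1 * ramp b n z.2.
  have f01 z : 0 <= f z <= 1.
    by rewrite mulr_ge0 ?mulr_ile1 ?ramp_ge0 ?ramp_le1.
  have cf : continuous f.
    move=> z.
    apply: (@continuousM _ _ (ramp a n \o fst) (ramp b n \o snd)).
      by apply: continuous_comp; [exact: cvg_fst|exact: continuous_ramp].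
    by apply: continuous_comp; [exact: cvg_snd|exact: continuous_ramp].
  have fi (m : probability (R * R)%type R) : m.-integrable setT (EFin \o f).
    apply: (@bounded_integrable_probability _ _ _ _ _ 1) => //.
      exact: continuous_prod_measurable_fun.
    by move=> z; have /andP[f0 f1] := f01 z; rewrite ger0_norm.
  by rewrite -[LHS](EFin_Rintegral measurableT (fi m2)) -m12// (EFin_Rintegral measurableT (fi m1)).
exact: quadrant_integral_cvg.
Qed.

(** * Densities and measurability of the family of laws *)

(** On [D] the function [h] agrees almost everywhere with the Radon-Nikodym derivative, because both
    have the same integral over every measurable subset of [D]. *)
Lemma integral_density {d} {T : measurableType d} {R : realType}
    (nu : {finite_measure set T -> \bar R})
    (mu : {sigma_finite_measure set T -> \bar R}) (D : set T)
    (f h : T -> \bar R) :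
  nu `<< mu -> measurable D -> measurable_fun D h ->
  (forall B, B `<=` D -> measurable B -> nu B = (\int[mu]_(x in B) h x)%E) ->
  nu.-integrable D f ->
  (\int[mu]_(x in D) (f x * h x) = \int[nu]_(x in D) f x)%E.
Proof.
move=> numu mD mh nuE nuf; have mf := measurable_int _ nuf.
rewrite -(Radon_Nikodym_change_of_variables numu)//=.
apply: ae_eq_integral => //.
- exact: emeasurable_funM.
- apply: emeasurable_funM => //.
  apply: (measurable_int mu); apply: (integrableS _ _ (@subsetT _ _)) => //=.
  exact: Radon_Nikodym_integrable.
- apply: ae_eqe_mul2l => /=; apply: ae_eq_sym.
  rewrite Radon_NikodymE//=; case: cid => /= g [g1 g2 g3].
  apply: integral_ae_eq => //=; first exact: integrableS g2.
  by move=> E ED mE; rewrite -g3//=; exact: nuE.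
Qed.

Section energy_law.
Context {R : realType} (nu : redistribution_measure R).
Implicit Types (s : R) (B : set R).
Local Notation I01 := (`[0%R, 1%R]%classic : set R).
Local Notation mu := (@lebesgue_measure R).

(* The clipping makes the family total: [rm_law] is unconstrained at negative
   energies. *)
Definition energy_law s : probability R R := rm_law nu (Num.max 0 s).

Lemma energy_lawE s : 0 <= s -> energy_law s = rm_law nu s.
Proof. by move=> s0; rewrite /energy_law max_r. Qed.

Lemma energy_law_density s B : measurable B -> energy_law s B =
  (\int[mu]_(e in B `&` I01) (rm_density nu (Num.max 0 s) e)%:E)%E.
Proof. by move=> mB; rewrite /energy_law rm_densityE// le_max lexx. Qed.

Lemma energy_law_setI01 s B : measurable B ->
  energy_law s (B `&` I01) = energy_law s B.
Proof.
by move=> mB; rewrite !energy_law_density// -?setIA ?setIid//; exact: measurableI.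
Qed.

Lemma energy_law01 s : energy_law s I01 = 1%E.
Proof.
by rewrite -[X in energy_law s X]setTI energy_law_setI01// probability_setT.
Qed.

Lemma energy_law_setC01 s : energy_law s (~` I01) = 0%E.
Proof. by rewrite probability_setC// energy_law01 subee. Qed.

(** Dynkin induction from the open rays, which are stable under intersection; complements and
    disjoint unions follow from the additivity of each law. *)
Lemma measurable_energy_law B :
  measurable B -> measurable_fun setT (fun s => energy_law s B).
Proof.
rewrite [measurable](RGenOInfty.measurableE R) => mB.
pattern B; apply: dynkin_induction mB.
- exact: RGenOInfty.measurableE.
- move=> _ _ [a ->] [b ->]; exists (Num.max a b).
  apply/seteqP; split => x /=; rewrite !in_itv/= !andbT gt_max;
    [by move=> [-> ->]|by move=> /andP[]].
- by apply: (eq_measurable_fun (cst 1%E)) => // s _; rewrite probability_setT.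
- move=> _ [a ->].
  (* By weak continuity [h n] is continuous in [s] on the half-line; composing with [Num.max 0]
     makes it measurable on all of [R]. *)
  pose h n s := (\int[energy_law s]_(e in I01) (ramp a n e)%:E)%E.
  apply: (emeasurable_fun_cvg h).
  + move=> n.
    pose G s := \int[rm_law nu s]_(e in I01) ramp a n e.
    have mG : measurable_fun (`[0, +oo[%classic : set R) G.
      apply: subspace_continuous_measurable_fun => //.
      apply: rm_weakly_continuous; apply: continuous_subspaceT.
      exact: continuous_ramp.
    apply: (eq_measurable_fun (EFin \o (G \o Num.max 0))).
      move=> s _ /=; rewrite EFin_Rintegral//.
      apply: (@bounded_integrable_probability _ _ _ _ _ 1) => //.
        exact: measurable_ramp.
      by move=> x; rewrite ger0_norm ?ramp_ge0 ?ramp_le1.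
    apply/measurable_EFinP; apply: (measurable_comp _ _ mG) => //.
      by move=> _ [s _ <-] /=; rewrite in_itv/= andbT le_max lexx.
    exact: measurable_maxr.
  (* Weak continuity concerns integrals over [[0, 1]], so the ray is first cut down to [[0, 1]],
     which does not change its mass. *)
  + move=> s _; rewrite /h -energy_law_setI01//.
    have -> : energy_law s (`]a, +oo[%classic `&` I01) =
        (\int[energy_law s]_(e in I01) (\1_`]a, +oo[ e)%:E)%E.
      by rewrite integral_indic.
    apply: (@dominated_cvg _ _ _ _ _ _ _ _ (cst 1%E)) => //.
    * move=> n; apply/measurable_EFinP; apply: measurable_funTS.
      exact: measurable_ramp.
    * by move=> x _; apply/cvg_EFin; [exact: nearW|exact: cvg_ramp].
    * exact: finite_measure_integrable_cst.
    * by move=> n x _ /=; rewrite lee_fin ger0_norm ?ramp_ge0 ?ramp_le1.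
- move=> A mA mfA; apply: (eq_measurable_fun (fun s => 1 - energy_law s A)%E).
    by move=> s _; rewrite probability_setC.
  exact: emeasurable_funB.
- move=> F mF tF mfF.
  apply: (eq_measurable_fun (fun s => \sum_(0 <= k <oo) energy_law s (F k))%E).
    by move=> s _; rewrite measure_semi_bigcup//; exact: bigcup_measurable.
  exact: ge0_emeasurable_sum.
Qed.

(** The density integrates to 0 over a Lebesgue-null set; this is the domination that
    [integral_density] asks for. *)
Lemma energy_law_dominates s : energy_law s `<< mu.
Proof.
apply/null_content_dominatesP => B mB B0; rewrite energy_law_density//.
have mB01 : measurable (B `&` I01) by exact: measurableI.
apply: null_set_integral => //.
  apply/measurable_EFinP; apply: (measurable_funS _ (@subIsetr _ _ _)) => //.
  by apply: rm_density_measurable; rewrite le_max lexx.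
by apply/eqP; rewrite eq_le measure_ge0 andbT -B0 le_measure ?inE.
Qed.

(** Turns the Lebesgue integral inside [transition_operator] into a mean under the law, to which
    results on kernels apply. *)
Lemma integral_energy_law s (f : R -> R) (M : R) :
  0 <= s -> measurable_fun setT f -> (forall x, `|f x| <= M) ->
  \int[mu]_(e in I01) (f e * rm_density nu s e) = \int[energy_law s]_e f e.
Proof.
move=> s0 mf fM.
have If D : measurable D -> (energy_law s).-integrable D (EFin \o f).
  by move=> mD; exact: (@bounded_integrable_probability _ _ _ _ _ M).
have md : measurable_fun I01 (EFin \o rm_density nu s).
  by apply/measurable_EFinP; exact: rm_density_measurable.
congr fine.
(* The law gives mass 0 to the complement of [[0, 1]], so the integral over the line reduces to
   [[0, 1]]. *)
transitivity (\int[energy_law s]_(e in I01) (f e)%:E)%E; last first.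
  rewrite [RHS](negligible_integral _ _ (If _ measurableT) (energy_law_setC01 s))//.
    by rewrite setTD setCK.
  exact: measurableC.
(* [lebesgue_measure] lives on [measurableTypeR R], whose measurable sets are
   those of [R] but whose display differs: transport the law along [id]. *)
pose mid : measurable_fun setT (id : R -> measurableTypeR R) :=
  @measurable_id _ R setT.
pose X : {mfun R >-> measurableTypeR R} :=
  HB.pack (id : R -> measurableTypeR R) (isMeasurableFun.Build _ _ _ _ _ mid).
pose law := distribution (energy_law s) X.
have law_dom : law `<< mu := @energy_law_dominates s.
have mf' : measurable_fun [set: measurableTypeR R] (EFin \o f).
  exact/measurable_EFinP.
have -> : (\int[energy_law s]_(e in I01) (f e)%:E =
           \int[law]_(e in I01) (f e)%:E)%E.
  by apply/esym/(integral_pushforward (phi := X)) => //; exact: (If I01).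
have lawf : law.-integrable I01 (EFin \o f).
  by apply: (integrable_pushforward (phi := X)) => //; exact: (If I01).
under eq_integral do rewrite EFinM.
apply: (integral_density (nu := law)) => //.
  by move=> B B01 mB; rewrite [LHS]energy_law_density// max_r// setIidl.
Qed.

End energy_law.

(** * The joint law of an energy and a fraction *)

Section joint_law.
Context {R : realType} (nu : redistribution_measure R).
Implicit Types (mu : probability R R).

(** The codomain is weakened from probabilities to measures so that the kernel structures can be
    attached. *)
Definition energy_kernel : R -> {measure set R -> \bar R} := energy_law nu.

HB.instance Definition _ :=
  isKernel.Build _ _ R R R energy_kernel (@measurable_energy_law R nu).

Let energy_kernelT s : energy_kernel s setT = 1%E.
Proof. exact: probability_setT. Qed.

HB.instance Definition _ :=
  Kernel_isProbability.Build _ _ R R R energy_kernel energy_kernelT.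

(** The product of the Dirac mass at [s] with the law at [s]. *)
Definition energy_slice (s : R) : giry (R * R)%type R :=
  giry_map (@measurable_pair1 _ _ R R s) (energy_law nu s).

(** The mass of [C] is the kernel mass of its section at [s], which is measurable in [s] for a
    finite kernel. *)
Lemma measurable_energy_slice : measurable_fun setT energy_slice.
Proof.
apply: measurable_giry_codensity => // C mC.
have := @measurable_fun_xsection_finite_kernel _ _ _ _ _ energy_kernel C.
rewrite inE => /(_ mC); apply: eq_measurable_fun => s _.
by rewrite xsectionE.
Qed.

(** The semidirect product of [mu] with the kernel. As a bind of the Giry monad it comes with its
    measure structure and its integration formula. *)
Definition joint_law mu : set (R * R) -> \bar R :=
  giry_bind (mu : giry R R) measurable_energy_slice.

HB.instance Definition _ mu := Measure.on (joint_law mu).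

Lemma integral_joint_law mu (h : R * R -> \bar R) :
  measurable_fun setT h -> (forall z, (0 <= h z)%E) ->
  (\int[joint_law mu]_z h z =
   \int[mu]_s \int[energy_law nu s]_e h (s, e))%E.
Proof.
move=> mh h0.
have := giry_int_bind (mu : giry R R) measurable_energy_slice mh h0.
rewrite /giry_int => ->; apply: eq_integral => s _.
by have := giry_int_map (@measurable_pair1 _ _ R R s) (energy_law nu s) mh h0.
Qed.

(** The indicator of a rectangle factors, so the inner integral is the mass of [B] on [A] and 0
    elsewhere. The resulting formula has the shape of [conditional_law]. *)
Lemma joint_lawX mu (A B : set R) : measurable A -> measurable B ->
  joint_law mu (A `*` B) = (\int[mu]_(s in A) energy_law nu s B)%E.
Proof.
move=> mA mB; have mAB := measurableX mA mB.
transitivity (\int[joint_law mu]_z (\1_(A `*` B) z)%:E)%E.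
  by rewrite integral_indic// setIT.
rewrite integral_joint_law//; last exact/measurable_EFinP.
rewrite [RHS]integral_mkcond; apply: eq_integral => s _.
under eq_integral do rewrite indicE in_setX -mulnb natrM EFinM -!indicE.
rewrite /= integralZl//; last exact: integrable_indic.
by rewrite integral_indic// setIT patchE indicE; case: (s \in A); rewrite ?mul1e ?mul0e.
Qed.

Let joint_lawT mu : joint_law mu setT = 1%E.
Proof.
rewrite -setXTT joint_lawX//; under eq_integral do rewrite probability_setT.
by rewrite integral_cst// mul1e; exact: probability_setT.
Qed.

HB.instance Definition _ mu :=
  Measure_isProbability.Build _ _ _ (joint_law mu) (joint_lawT mu).

Section bounded.
Variables (f : R * R -> R) (M : R).
Hypotheses (mf : measurable_fun setT f) (fM : forall z, `|f z| <= M).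

(** Kernel measurability and the bind formula are applied to nonnegative functions; adding [M] makes
    [f] one. *)
Let h0 z : 0 <= f z + M.
Proof. by have := fM z; rewrite ler_norml => /andP[]; lra. Qed.

Let fi s D : measurable D ->
  (energy_law nu s).-integrable D (fun e => (f (s, e))%:E).
Proof.
move=> mD; apply: (@bounded_integrable_probability _ _ _ _ (fun e => f (s, e)) M) => //.
by apply: measurableT_comp => //; exact: measurable_pair1.
Qed.

Lemma normr_Rintegral_energy_law_le s : `|\int[energy_law nu s]_e f (s, e)| <= M.
Proof.
apply: (le_trans (le_normr_Rintegral _ (fi s _))) => //.
rewrite -[leRHS](Rintegral_cst_probability (energy_law nu s)).
apply: le_Rintegral => //.
- exact: integrable_norm (fi _ _).
- exact: finite_measure_integrable_cst.
Qed.

Let energy_meanD s : (\int[energy_law nu s]_e f (s, e) + M)%:E =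
  (\int[energy_law nu s]_e (f (s, e) + M)%:E)%E.
Proof.
rewrite EFinD EFin_Rintegral//; last exact: fi.
under [RHS]eq_integral do rewrite EFinD.
rewrite integralD//; [|exact: fi|exact: finite_measure_integrable_cst].
by rewrite integral_cst// [X in (_ * X)%E]probability_setT mule1.
Qed.

Lemma measurable_Rintegral_energy_law :
  measurable_fun setT (fun s => \int[energy_law nu s]_e f (s, e)).
Proof.
apply: (eq_measurable_fun
  (fun s => (\int[energy_law nu s]_e f (s, e) + M) - M)).
  by move=> s _; rewrite addrK.
apply: measurable_funB => //; apply/measurable_EFinP.
apply: (eq_measurable_fun (fun s => \int[energy_law nu s]_e (f (s, e) + M)%:E)%E).
  by move=> s _ /=; rewrite energy_meanD.
apply: (measurable_fun_integral_finite_kernel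
  (fun z => (f z + M)%:E) energy_kernel) => //.
by apply/measurable_EFinP; exact: measurable_funD.
Qed.

Lemma Rintegral_joint_law mu :
  \int[joint_law mu]_z f z = \int[mu]_s \int[energy_law nu s]_e f (s, e).
Proof.
have fJ : (joint_law mu).-integrable setT (EFin \o f).
  exact: (@bounded_integrable_probability _ _ _ _ _ M).
have gi : mu.-integrable setT
    (EFin \o fun s => \int[energy_law nu s]_e f (s, e)).
  apply: (@bounded_integrable_probability _ _ _ _ _ M) => //.
    exact: measurable_Rintegral_energy_law.
  exact: normr_Rintegral_energy_law_le.
(* The added [M] is the integral of a constant under either probability, so it can be absorbed on
   both sides. *)
apply: (@addIr _ M).
rewrite -[X in _ + X = _](Rintegral_cst_probability (joint_law mu)).
rewrite -[X in _ = _ + X](Rintegral_cst_probability mu).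
rewrite -!RintegralD//; try exact: finite_measure_integrable_cst.
rewrite /Rintegral integral_joint_law//; last first.
  by apply/measurable_EFinP; exact: measurable_funD.
by congr fine; apply: eq_integral => s _; rewrite -energy_meanD.
Qed.

End bounded.

End joint_law.

(** * Push-forwards and the mean of a test function after a split *)

Lemma Rintegral_distribution {d d'} {T : measurableType d}
    {T' : measurableType d'} {R : realType} (P : probability T R)
    (X : {mfun T >-> T'}) (f : T' -> R) (M : R) :
  measurable_fun setT f -> (forall y, `|f y| <= M) ->
  \int[distribution P X]_y f y = \int[P]_x f (X x).
Proof.
move=> mf fM; congr fine; apply: integral_distribution.
  exact/measurable_EFinP.
apply: (@bounded_integrable_probability _ _ _ _ (f \o X) M) => //.
  exact: measurableT_comp.
by move=> x; exact: fM.
Qed.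

Lemma measurable_fun_split {R : realType} (f : R * R -> R) :
  measurable_fun setT f ->
  measurable_fun setT (fun z : R * R => f (z.2 * z.1, (1 - z.2) * z.1)).
Proof.
move=> mf; apply: measurableT_comp => //; apply: measurable_fun_pair.
  exact: measurable_funM.
by apply: measurable_funM => //; exact: measurable_funB.
Qed.

Section split_mean.
Context {R : realType} (nu : redistribution_measure R).
Variables (f : R * R -> R) (M : R).
Hypotheses (mf : measurable_fun setT f) (fM : forall z, `|f z| <= M).

(** The function [G] for which [Pf(x, y)] is [G(x + y)] on the state space. *)
Definition split_mean s :=
  \int[energy_law nu s]_e f (e * s, (1 - e) * s).

Let g (z : R * R) := f (z.2 * z.1, (1 - z.2) * z.1).

Let mg : measurable_fun setT g.
Proof. exact: measurable_fun_split. Qed.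

Let gM z : `|g z| <= M.
Proof. exact: fM. Qed.

Lemma measurable_split_mean : measurable_fun setT split_mean.
Proof. exact: (measurable_Rintegral_energy_law nu mg gM). Qed.

Lemma normr_split_mean_le s : `|split_mean s| <= M.
Proof. exact: (normr_Rintegral_energy_law_le nu mg gM). Qed.

Lemma Rintegral_joint_law_split (mu : probability R R) :
  \int[joint_law nu mu]_z f (z.2 * z.1, (1 - z.2) * z.1) =
  \int[mu]_s split_mean s.
Proof. exact: (Rintegral_joint_law nu mg gM). Qed.

End split_mean.

(** * The joint law of a pair satisfying the conditional law *)

Section conditional_law.
Context {R : realType} (nu : redistribution_measure R).
Context d (Omega : measurableType d) (P : probability Omega R).
Variables S eps : {RV P >-> R}.
Hypotheses (S_ge0 : forall w, 0 <= S w) (S_eps : conditional_law nu S eps).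
Local Notation half_line := (`[0%R, +oo[%classic : set R).

Let SE w := (S w, eps w).

Let mSE : measurable_fun setT SE.
Proof. exact: measurable_fun_pair. Qed.

HB.instance Definition _ := isMeasurableFun.Build _ _ _ _ SE mSE.

(** Both probabilities agree on measurable rectangles, which generate the product sigma-algebra and
    are stable under intersection. *)
Lemma distribution_conditional_law (C : set (R * R)) : measurable C ->
  distribution P SE C = joint_law nu (distribution P S) C.
Proof.
apply: (measure_unique [set A `*` B | A in measurable & B in measurable]
  (fun=> setT)).
- exact: measurable_prod_measurableType.
- move=> _ _ [A1 mA1 [B1 mB1 <-]] [A2 mA2 [B2 mB2 <-]].
  exists (A1 `&` A2); first exact: measurableI.
  by exists (B1 `&` B2); [exact: measurableI|rewrite setXI].
- by move=> _; exists setT => //; exists setT => //; rewrite setXTT.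
- by rewrite bigcup_const.
- move=> _ [A mA [B mB <-]]; rewrite [RHS]joint_lawX//.
  (* [conditional_law] covers only sets of nonnegative energies. The negative half-line, null for
     the law of [S], is therefore removed from [A] first. *)
  rewrite (ge0_negligible_integral (N := ~` half_line) _ mA)//; last 3 first.
  + exact: measurableC.
  + by apply: measurable_funTS; exact: measurable_energy_law.
  + transitivity (P set0); last exact: measure0.
    congr (P _); apply/seteqP; split => // w /=.
    by rewrite in_itv/= andbT S_ge0.
  rewrite setDE setCK.
  transitivity (P (S @^-1` (A `&` half_line) `&` eps @^-1` B)).
    congr (P _); apply/seteqP; split => w /=.
      by move=> [? ?]; rewrite in_itv/= S_ge0.
    by move=> [[]].
  rewrite S_eps//; last exact: measurableI.
  apply: eq_integral => s; rewrite inE/= in_itv/= andbT => -[_ s0].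
  by rewrite energy_lawE.
- by move=> _; rewrite (le_lt_trans (probability_le1 _ _)) ?ltry.
Qed.

(** The split pair is a function of [(S, eps)], whose law is the joint law; integrating out the
    fraction leaves [split_mean]. *)
Lemma Rintegral_energy_split (f : R * R -> R) (M : R) :
  measurable_fun setT f -> (forall z, `|f z| <= M) ->
  \int[distribution P (energy_split S eps)]_z f z =
  \int[distribution P S]_s split_mean nu f s.
Proof.
move=> mf fM; rewrite -(Rintegral_joint_law_split _ mf fM).
rewrite (Rintegral_distribution _ _ mf fM).
pose g (z : R * R) := f (z.2 * z.1, (1 - z.2) * z.1).
have mg : measurable_fun setT g by exact: measurable_fun_split.
have gM z : `|g z| <= M by exact: fM.
rewrite -[LHS](Rintegral_distribution P SE mg gM).
congr fine; apply: eq_measure_integral => C mC _.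
exact: distribution_conditional_law.
Qed.

End conditional_law.

(** * Test functions and the transition operator on the state space *)

Section state_space.
Context {R : realType} (nu : redistribution_measure R).
Local Notation E := (@state_space R).

Lemma measurable_state_space : measurable E.
Proof.
rewrite (_ : E = `[0, +oo[%classic `*` `[0, +oo[%classic).
  exact: measurableX.
by apply/seteqP; split => -[x y]; rewrite /state_space/= !in_itv/= !andbT.
Qed.

(** Invariance is tested on functions continuous on the quadrant only. Composing them with a
    retraction onto it gives functions on the whole plane, as the integral lemmas require. *)
Lemma extend_state_space (f : R * R -> R) :
  {within E, continuous f} -> [bounded f z | z in E] ->
  exists g M, [/\ continuous g, forall z, `|g z| <= M & {in E, f =1 g}].
Proof.
move=> /continuousP cf [M0 [_ fM0]].
(* Clipping both coordinates at 0 is a continuous retraction of the plane onto [E]. *)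
pose c (z : R * R) := (Num.max 0 z.1, Num.max 0 z.2).
have cE z : E (c z) by split; rewrite le_max lexx.
have cc : continuous c.
  move=> z.
  have c1 : {for z, continuous (cst 0 \max fst : R * R -> R)}.
    by apply: (@continuous_max R); [exact: cvg_cst|exact: cvg_fst].
  have c2 : {for z, continuous (cst 0 \max snd : R * R -> R)}.
    by apply: (@continuous_max R); [exact: cvg_cst|exact: cvg_snd].
  exact: (cvg_pair c1 c2).
(* Boundedness provides a bound for each number strictly above [M0], hence the 1. *)
exists (f \o c), (M0 + 1); split.
- apply/continuousP => O /cf /open_subspaceP[V oV VE].
  rewrite (_ : _ @^-1` _ = c @^-1` V); first by move/continuousP : cc; exact.
  apply/seteqP; split => z zO.
    by have [] : (V `&` E) (c z) by rewrite VE; split => //; exact: cE.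
  by have [] : (from_subspace E f @^-1` O `&` E) (c z) by rewrite -VE; split.
- by move=> z; apply: (fM0 _ _ (c z) (cE z)); rewrite ltrDl.
- by move=> [x y]; rewrite inE => -[/= x0 y0]; rewrite /c/= !max_r.
Qed.

(** For [e] in [[0, 1]] redistribution maps [E] into itself, so [f] may be replaced by its extension
    under the integral. *)
Lemma transition_operatorE (f g : R * R -> R) (M : R) (z : R * R) :
  measurable_fun setT g -> (forall z, `|g z| <= M) -> {in E, f =1 g} -> E z ->
  transition_operator nu f z =
  split_mean nu g (z.1 + z.2).
Proof.
move=> mg gM fg [z1 z2]; have s0 : 0 <= z.1 + z.2 by exact: addr_ge0.
rewrite /split_mean -(@integral_energy_law _ nu _ _ M s0)//; last first.
  apply: measurableT_comp => //; apply: measurable_fun_pair.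
    exact: measurable_funM.
  by apply: measurable_funM => //; exact: measurable_funB.
apply: eq_Rintegral => e; rewrite inE/= in_itv/= => /andP[e0 e1].
by rewrite fg// inE; split; rewrite /redistribute mulr_ge0// subr_ge0.
Qed.

Lemma Rintegral_full (m : probability (R * R)%type R) (f : R * R -> R) (M : R) :
  m E = 1%E -> measurable_fun setT f -> (forall z, `|f z| <= M) ->
  \int[m]_(z in E) f z = \int[m]_z f z.
Proof.
move=> mE mf fM; have mSE := measurable_state_space.
have mC : m (~` E) = 0%E by rewrite probability_setC// mE subee.
congr fine; rewrite [RHS](negligible_integral _ _ _ mC)//.
- by rewrite setTD setCK.
- exact: measurableC.
- exact: (@bounded_integrable_probability _ _ _ _ _ M).
Qed.

Lemma Rintegral_transition_operator (m : probability (R * R)%type R)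
    (f g : R * R -> R) (M : R) :
  m E = 1%E -> measurable_fun setT g -> (forall z, `|g z| <= M) ->
  {in E, f =1 g} ->
  \int[m]_(z in E) transition_operator nu f z =
  \int[m]_z split_mean nu g (z.1 + z.2).
Proof.
move=> mE mg gM fg.
rewrite -(Rintegral_full (M := M) mE); last first.
- by move=> z; exact: normr_split_mean_le.
- apply: measurableT_comp; first exact: measurable_split_mean mg gM.
  exact: measurable_funD.
apply: eq_Rintegral => z; rewrite inE => Ez.
exact: (transition_operatorE mg gM fg Ez).
Qed.

End state_space.

(** * Split laws are invariant *)

Lemma is_invariant_energy_split {R : realType} (nu : redistribution_measure R)
    d (Omega : measurableType d) (P : probability Omega R)
    (S eps : {RV P >-> R}) :
  (forall w, 0 <= S w) -> (forall w, 0 <= eps w <= 1) ->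
  conditional_law nu S eps ->
  is_invariant nu (distribution P (energy_split S eps)).
Proof.
move=> S0 eps01 S_eps; set m := distribution _ _.
have mE : m (@state_space R) = 1%E.
  transitivity (P setT); last exact: probability_setT.
  congr (P _); apply/seteqP; split => // w _; have /andP[e0 e1] := eps01 w.
  by split; rewrite /= mulr_ge0// subr_ge0.
split=> // f cf bf; have [g [M [cg gM fg]]] := extend_state_space cf bf.
have mg := continuous_prod_measurable_fun cg.
rewrite (Rintegral_transition_operator nu mE mg gM fg).
transitivity (\int[m]_z g z); last first.
  rewrite -(Rintegral_full mE mg gM).
  by apply: eq_Rintegral => z zE; rewrite fg.
have mG := measurable_split_mean nu mg gM.
have GM := normr_split_mean_le nu mg gM.
rewrite (Rintegral_energy_split S0 S_eps mg gM).
rewrite [RHS](Rintegral_distribution P S mG GM).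
have mGsum : measurable_fun setT (fun z : R * R => split_mean nu g (z.1 + z.2)).
  by apply: measurableT_comp => //; exact: measurable_funD.
rewrite (Rintegral_distribution _ _ mGsum (fun z => GM _)).
(* The two coordinates of the split add up to [S w]. *)
by apply: eq_Rintegral => w _; rewrite /= -mulrDl addrC subrK mul1r.
Qed.

(** * Every invariant probability measure is a split law *)

Section canonical_variables.
Context {R : realType}.

(* [energy_coord] and [fraction_coord] are the variables [S] and [eps] on
   [R * R] under [joint_law nu mu]; clipping makes the bounds required of them
   hold everywhere and not merely almost surely. *)
Definition total_energy (z : R * R) : R := Num.max 0 (z.1 + z.2).
Definition energy_coord (z : R * R) : R := Num.max 0 z.1.
Definition fraction_coord (z : R * R) : R := Num.min 1 (Num.max 0 z.2).

Let measurable_total_energy : measurable_fun setT total_energy.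
Proof. by apply: measurable_maxr => //; exact: measurable_funD. Qed.

Let measurable_energy_coord : measurable_fun setT energy_coord.
Proof. exact: measurable_maxr. Qed.

Let measurable_fraction_coord : measurable_fun setT fraction_coord.
Proof. by apply: measurable_minr => //; exact: measurable_maxr. Qed.

HB.instance Definition _ :=
  isMeasurableFun.Build _ _ _ _ total_energy measurable_total_energy.
HB.instance Definition _ :=
  isMeasurableFun.Build _ _ _ _ energy_coord measurable_energy_coord.
HB.instance Definition _ :=
  isMeasurableFun.Build _ _ _ _ fraction_coord measurable_fraction_coord.

Lemma energy_coord_ge0 z : 0 <= energy_coord z.
Proof. by rewrite le_max lexx. Qed.

Lemma fraction_coord01 z : 0 <= fraction_coord z <= 1.
Proof. by rewrite le_min ler01 le_max lexx ge_min lexx. Qed.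

Variables (nu : redistribution_measure R) (m : probability (R * R)%type R).
Let mu : probability R R := distribution m total_energy.
Let P : probability (R * R)%type R := joint_law nu mu.

(** The first marginal of the joint law is [mu], and clipping at 0 preserves it because
    [total_energy] is already clipped. *)
Lemma distribution_energy_coord (C : set R) : measurable C ->
  distribution P energy_coord C = mu C.
Proof.
move=> mC; have mD : measurable ((Num.max 0) @^-1` C : set R).
  by rewrite -[X in measurable X]setTI; exact: measurable_maxr.
transitivity (joint_law nu mu (((Num.max 0) @^-1` C) `*` setT)).
  by congr (joint_law nu mu _); apply/seteqP; split => -[x y] //= [].
rewrite joint_lawX//; under eq_integral do rewrite probability_setT.
rewrite integral_cst// mul1e; congr (m _).
by apply/seteqP; split => z; rewrite /= /total_energy maxA maxxx.
Qed.

(** On rectangles the joint law has the required form. Clipping the energy matters only on the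
    negative half-line, null for [mu], and clipping the fraction only outside [[0, 1]], null for
    each law. *)
Lemma conditional_law_coord :
  conditional_law nu (energy_coord : {RV P >-> R}) (fraction_coord : {RV P >-> R}).
Proof.
move=> A B mA mB A0.
have A_ge0 s : A s -> 0 <= s by move=> /A0; rewrite /= in_itv/= andbT.
have mA' : measurable ((Num.max 0) @^-1` A : set R).
  by rewrite -[X in measurable X]setTI; exact: measurable_maxr.
have mB' : measurable ((fun e => Num.min 1 (Num.max 0 e)) @^-1` B : set R).
  rewrite -[X in measurable X]setTI.
  by apply: measurable_minr => //; exact: measurable_maxr.
have mu_neg : mu (~` (`[0, +oo[%classic : set R)) = 0%E.
  transitivity (m set0); last exact: measure0.
  congr (m _); apply/seteqP; split => // z /=.
  by rewrite in_itv/= andbT /total_energy le_max lexx.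
transitivity (joint_law nu mu (((Num.max 0) @^-1` A) `*`
    ((fun e => Num.min 1 (Num.max 0 e)) @^-1` B))) => //.
rewrite joint_lawX// (ge0_negligible_integral _ mA' _ _ mu_neg)//; last 2 first.
- exact: measurableC.
- by apply: measurable_funTS; exact: measurable_energy_law.
(* If [A] contains 0, its preimage under clipping also contains the negative numbers; removing them
   recovers [A]. *)
have -> : (Num.max 0 @^-1` A) `\` ~` `[0, +oo[%classic = A.
  rewrite setDE setCK; apply/seteqP; split => s /=; rewrite in_itv/= andbT.
    by move=> [+ s0]; rewrite max_r.
  by move=> As; rewrite max_r ?A_ge0.
transitivity (\int[distribution P energy_coord]_(s in A) energy_law nu s B)%E.
  rewrite [RHS](@eq_measure_integral _ _ _ _ mu); last first.
    by move=> C mC _; exact: distribution_energy_coord.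
  apply: eq_integral => s _; rewrite -energy_law_setI01// -[RHS]energy_law_setI01//.
  congr (energy_law nu s _); apply/seteqP.
  split => e [/= + e01]; move: (e01); rewrite /= in_itv/= => /andP[e0 e1];
  by rewrite max_r// min_r.
by apply: eq_integral => s; rewrite inE => /A_ge0 s0; rewrite energy_lawE.
Qed.

Lemma invariant_distribution_coord : is_invariant nu m ->
  forall C, measurable C ->
  m C = distribution P (energy_split energy_coord fraction_coord) C.
Proof.
move=> [mE inv]; apply: measure_eq_continuous => f cf f01.
have mf := continuous_prod_measurable_fun cf.
have fM z : `|f z| <= 1 by have /andP[f0 f1] := f01 z; rewrite ger0_norm.
have mG := measurable_split_mean nu mf fM.
have GM := normr_split_mean_le nu mf fM.
rewrite (Rintegral_energy_split energy_coord_ge0 conditional_law_coord mf fM).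
transitivity (\int[mu]_s split_mean nu f s); last first.
  congr fine; apply: eq_measure_integral => C mC _.
  by rewrite [RHS]distribution_energy_coord.
rewrite [RHS](Rintegral_distribution m total_energy mG GM).
(* Invariance enters here: [f] is exchanged for its image under the transition operator. *)
rewrite -(Rintegral_full mE mf fM) -inv; last 2 first.
- exact: continuous_subspaceT.
- exists 1; split => // M M1 z _ /=; exact: le_trans (fM z) (ltW M1).
rewrite (Rintegral_transition_operator (f := f) nu mE mf fM)//.
have mGs (h : R * R -> R) : measurable_fun setT h ->
    measurable_fun setT (split_mean nu f \o h).
  by move=> mh; exact: measurableT_comp.
(* Both integrals are cut down to the state space, where [total_energy] is the plain sum of the
   coordinates. *)
rewrite -(Rintegral_full (f := fun z => split_mean nu f (z.1 + z.2)) mE _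
  (fun=> GM _)); last first.
  by apply: mGs; exact: measurable_funD.
rewrite -(Rintegral_full (f := fun z => split_mean nu f (total_energy z)) mE _
  (fun=> GM _)); last first.
  exact: mGs.
apply: eq_Rintegral => z; rewrite inE => -[z1 z2].
by rewrite /total_energy max_r// addr_ge0.
Qed.

End canonical_variables.

Unset Implicit Arguments.

Theorem theorem3p2 (R : realType) (nu : redistribution_measure R) :
  (forall (d : measure_display) (Omega : measurableType d)
      (P : probability Omega R) (S eps : {RV P >-> R}),
    (forall w, 0 <= S w) ->
    (forall w, 0 <= eps w <= 1) ->
    conditional_law nu S eps ->
    is_invariant nu (distribution P (energy_split S eps))) /\
  (forall m : probability (R * R)%type R,
    is_invariant nu m ->
    exists (d : measure_display) (Omega : measurableType d)
      (P : probability Omega R) (S eps : {RV P >-> R}),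
      [/\ forall w, 0 <= S w,
          forall w, 0 <= eps w <= 1,
          conditional_law nu S eps &
          forall A, measurable A ->
            m A = distribution P (energy_split S eps) A]).
Proof.
split=> [d Omega P S eps|m m_inv]; first exact: is_invariant_energy_split.
exists _, (R * R)%type, (joint_law nu (distribution m total_energy)),
  energy_coord, fraction_coord; split.
- exact: energy_coord_ge0.
- exact: fraction_coord01.
- exact: conditional_law_coord.
- exact: invariant_distribution_coord.
Qed.
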